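(* For all integers $k\ge 1$ and $\ell\ge 1$, there are only finitely many $k$-vertex-critical $(2P_2,(4,\ell)\text{-}squid)$-free graphs.
   Context: Graphs are finite and simple, and ''finitely many'' means up to isomorphism. A graph $G$ is $k$-vertex-critical if $\chi(G)=k$ and $\chi(G-v)<k$ for all $v\in V(G)$, where $\chi$ denotes the chromatic number. A graph is $(H_1,H_2)$-free if it contains no induced subgraph isomorphic to $H_1$ or $H_2$. $2P_2$ is the disjoint union of two edges. For $\ell\ge 1$, the $(4,\ell)$-$squid$ is the graph obtained from the cycle $C_4$ by attaching $\ell$ leaves (pendant vertices) to a single vertex of the cycle. *)

(* Defs.v *)
From mathcomp Require Import all_boot.

Set Implicit Arguments.
Unset Strict Implicit.
Unset Printing Implicit Defensive.

Record sgraph := SGraph {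
  vertex :> finType;
  adj : rel vertex;
  adj_sym : symmetric adj;
  adj_irr : irreflexive adj
}.

Definition isomorphic (G H : sgraph) : Prop :=
  exists2 f : G -> H, bijective f & {mono f : x y / adj x y}.

(* "Finitely many up to isomorphism": finitely many graphs represent all the
   graphs satisfying P. *)
Definition finitely_many (P : sgraph -> Prop) : Prop :=
  exists (n : nat) (F : 'I_n -> sgraph),
    forall G, P G -> exists i, isomorphic G (F i).

Section Induced.
Variables (G : sgraph) (S : {set G}).

Definition induced_adj : rel {x | x \in S} := fun x y => adj (val x) (val y).

Lemma induced_sym : symmetric induced_adj.
Proof. by move=> x y; apply: adj_sym. Qed.

Lemma induced_irr : irreflexive induced_adj.
Proof. by move=> x; apply: adj_irr. Qed.

Definition induced : sgraph := SGraph induced_sym induced_irr.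

End Induced.

Definition delete_vertex (G : sgraph) (v : G) : sgraph := induced [set~ v].

Definition free_of (H G : sgraph) : Prop :=
  ~ exists S : {set G}, isomorphic H (induced S).

Definition colorable (G : sgraph) (k : nat) : bool :=
  [exists c : {ffun G -> 'I_k},
     [forall x, forall y, adj x y ==> (c x != c y)]].

Lemma colorable_card (G : sgraph) : colorable G #|G|.
Proof.
apply/existsP; exists [ffun x => enum_rank x].
apply/forallP => x; apply/forallP => y; apply/implyP => xy.
rewrite !ffunE; apply: contraTneq xy => /enum_rank_inj ->.
by rewrite adj_irr.
Qed.

Lemma colorable_exists (G : sgraph) : exists k, colorable G k.
Proof. by exists #|G|; apply: colorable_card. Qed.

Definition chromatic_number (G : sgraph) : nat := ex_minn (colorable_exists G).

Definition vertex_critical (k : nat) (G : sgraph) : Prop :=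
  chromatic_number G = k /\
  forall v : G, chromatic_number (delete_vertex v) < k.

Section DisjointUnion.
Variables G H : sgraph.

Definition union_adj : rel (G + H) := fun x y =>
  match x, y with
  | inl u, inl v => adj u v
  | inr u, inr v => adj u v
  | _, _ => false
  end.

Lemma union_sym : symmetric union_adj.
Proof. by move=> [x|x] [y|y] //=; apply: adj_sym. Qed.

Lemma union_irr : irreflexive union_adj.
Proof. by move=> [x|x] /=; apply: adj_irr. Qed.

Definition disjoint_union : sgraph := SGraph union_sym union_irr.

End DisjointUnion.

Section Path.
Variable n : nat.

Definition path_adj : rel 'I_n := fun i j => (j == i.+1 :> nat) || (i == j.+1 :> nat).

Lemma path_sym : symmetric path_adj.
Proof. by move=> i j; rewrite /path_adj orbC. Qed.

Lemma path_irr : irreflexive path_adj.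
Proof. by move=> i; rewrite /path_adj orbb ltn_eqF. Qed.

Definition path_graph : sgraph := SGraph path_sym path_irr.

End Path.

Definition two_P2 : sgraph := disjoint_union (path_graph 2) (path_graph 2).

Section Squid.
Variable l : nat.

(* 'I_4 is the cycle C_4 (ordS is the cyclic successor), and 'I_l is the set
   of leaves, all attached to the vertex ord0 of the cycle. *)
Definition squid4_adj : rel ('I_4 + 'I_l) := fun x y =>
  match x, y with
  | inl i, inl j => (j == ordS i) || (i == ordS j)
  | inl i, inr _ | inr _, inl i => i == ord0
  | inr _, inr _ => false
  end.

Lemma squid4_sym : symmetric squid4_adj.
Proof. by move=> [i|i] [j|j] //=; rewrite orbC. Qed.

Lemma squid4_irr : irreflexive squid4_adj.
Proof. by case=> [[[|[|[|[|i]]]] ?]|]. Qed.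

Definition squid4 : sgraph := SGraph squid4_sym squid4_irr.

End Squid.

(* Main.v *)
Require Import Defs.
From mathcomp Require Import all_boot.

(** Distinct nonadjacent vertices of a vertex-critical graph have incomparable
    neighbourhoods, and in a [2P_2]-free graph the neighbourhoods of the vertices
    of an independent set, traced on another independent set, form a chain. A
    large [k]-colourable graph has a large independent set [R]. For [a] in [R],
    pigeonhole gives colours [i], [i'] and a large [R'] in [R] such that every
    [b] in [R'] is separated from [a] by a neighbour of [a] of colour [i] and by
    a neighbour of [b] of colour [i']; by the chain property some [y] of colour
    [i] sees [a] and nothing in [R'], and some [x] of colour [i'] sees all of
    [R'] but not [a]. Iterating inside [R'], the colour [i] repeats after at most
    [k + 1] rounds, which gives [a, x, y] and then [a', y'], with [y] and [y']
    of the same colour; then [x, y, a, y'] is an induced [C_4], and [l] vertices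
    of the last [R'] are leaves at [x]. *)

(** * Forbidden induced subgraphs *)

Lemma embedding_not_free (H G : sgraph) (f : H -> G) :
  injective f -> {mono f : x y / adj x y} -> ~ free_of H G.
Proof.
move=> inj_f mono_f; apply; exists (f @: [set: H]).
have fP x : f x \in f @: [set: H] by rewrite imset_f.
exists (fun x => exist _ (f x) (fP x) : induced (f @: [set: H])) => //.
apply: inj_card_bij => [x y [/inj_f] //|].
by rewrite card_sig -cardsT card_imset // cardsT.
Qed.

Lemma adj_neq {G : sgraph} {x y : G} : adj x y -> x != y.
Proof. by apply: contraTneq => ->; rewrite adj_irr. Qed.

Lemma two_P2_freeP {G : sgraph} : free_of two_P2 G ->
  forall a b c d : G, adj a b -> adj c d ->
    ~~ adj a c -> ~~ adj a d -> ~~ adj b c -> ~~ adj b d -> False.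
Proof.
move=> free a b c d ab cd /negbTE ac /negbTE ad /negbTE bc /negbTE bd.
pose f (u : two_P2) : G := match u with
  | inl i => if i == ord0 then a else b
  | inr i => if i == ord0 then c else d end.
have ba : adj b a by rewrite adj_sym.
have dc : adj d c by rewrite adj_sym.
have [ca da] : adj c a = false /\ adj d a = false by rewrite ![adj _ a]adj_sym.
have [cb db] : adj c b = false /\ adj d b = false by rewrite ![adj _ b]adj_sym.
have mono_f : {mono f : x y / adj x y}.
  by move=> [[[|[|?]] ?]|[[|[|?]] ?]] [[[|[|?]] ?]|[[|[|?]] ?]] //=;
    rewrite ?adj_irr ?ab ?ba ?cd ?dc ?ac ?ad ?bc ?bd ?ca ?cb ?da ?db.
apply: (embedding_not_free _ _ f _ mono_f free) => u v fuv.
(* [f u = f v] makes [u] and [v] twins, and [2P_2] has no twins *)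
have tw w : adj u w = adj v w by rewrite -!mono_f fuv.
by move: u v tw {fuv} => [[[|[|?]] ?]|[[|[|?]] ?]] [[[|[|?]] ?]|[[|[|?]] ?]] tw //=;
  try (by congr inl; apply: val_inj); try (by congr inr; apply: val_inj);
  have := tw (inl ord0); have := tw (inr ord0);
  have := tw (inl ord_max); have := tw (inr ord_max).
Qed.

(** Opposite vertices of [C_4] have the same neighbours on the cycle, so adjacency within the cycle
    does not separate them; hence the hypotheses [a != x] and [y != z]. *)
Lemma squid4_freeP {G : sgraph} {l : nat} : free_of (squid4 l) G ->
  forall (x y a z : G) (L : {set G}), l <= #|L| ->
    adj x y -> adj y a -> adj a z -> adj z x -> ~~ adj x a -> ~~ adj y z ->
    a != x -> y != z ->
    {in L &, forall b c, ~~ adj b c} ->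
    {in L, forall b, [/\ adj x b, ~~ adj y b, ~~ adj a b & ~~ adj z b]} ->
  False.
Proof.
move=> free x y a z L leL xy ya az zx /negbTE xa /negbTE yz neax neyz indL hL.
pose g (t : 'I_l) : G := enum_val (widen_ord leL t).
have gL t : g t \in L by apply: enum_valP.
have inj_g : injective g.
  by move=> s t /enum_val_inj /(congr1 val) /= st; apply: val_inj.
pose f (u : squid4 l) : G := match u with
  | inl i => nth x [:: x; y; a; z] i | inr t => g t end.
have [yx ay za xz] : [/\ adj y x, adj a y, adj z a & adj x z].
  by split; rewrite adj_sym.
have [ax zy] : adj a x = false /\ adj z y = false.
  by rewrite [adj a x]adj_sym [adj z y]adj_sym.
have hg t : (adj x (g t) = true) * (adj y (g t) = false) *
            (adj a (g t) = false) * (adj z (g t) = false).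
  by have [-> /negbTE-> /negbTE-> /negbTE->] := hL _ (gL t).
have gg s t : adj (g s) (g t) = false by apply/negbTE/indL.
have mono_f : {mono f : u v / adj u v}.
  by move=> [[[|[|[|[|?]]]] ?]|s] [[[|[|[|[|?]]]] ?]|t] //=;
    rewrite ?gg // ?[adj (g _) _]adj_sym ?hg ?adj_irr;
    rewrite ?xy ?yx ?ya ?ay ?az ?za ?zx ?xz ?xa ?ax ?yz ?zy.
apply: (embedding_not_free _ _ f _ mono_f free).
have uniqC : uniq [:: x; y; a; z].
  by rewrite /= !inE !negb_or !(eq_sym x) neax neyz
    !(adj_neq yx, adj_neq zx, adj_neq ya, adj_neq az).
have gC t : g t \notin [:: x; y; a; z].
  rewrite !inE !negb_or; apply/and4P; split.
  - by rewrite eq_sym adj_neq // hg.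
  - by apply: contraTneq ay => <-; rewrite hg.
  - by apply: contraTneq az => eq; rewrite adj_sym -eq hg.
  - by apply: contraTneq az => <-; rewrite hg.
move=> [i|s] [j|t] //= fuv.
- congr inl; apply: val_inj => /=; apply/eqP.
  by rewrite -(nth_uniq x _ _ uniqC) // fuv.
- by have := gC t; rewrite -fuv mem_nth.
- by have := gC s; rewrite fuv mem_nth.
- by congr inr; apply: inj_g.
Qed.

(* The first hypothesis says that the rows [{b in R | r x b}], [x] in [C], form a
   chain. *)
Lemma nested_rows_common {T U : finType} {r : T -> U -> bool}
    {C : {set T}} {R : {set U}} :
  (forall x y b c, x \in C -> y \in C -> b \in R -> c \in R ->
     r x b -> ~~ r y b -> r y c -> r x c) ->
  R != set0 -> (forall b, b \in R -> exists2 x, x \in C & r x b) ->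
  exists2 x, x \in C & forall b, b \in R -> r x b.
Proof.
move=> nest /set0Pn[b0 b0R] rows; have [x0 x0C _] := rows b0 b0R.
pose row x := [set b in R | r x b].
(* A largest row is all of [R]: a row through a missed [b] would properly contain it. *)
case: (arg_maxnP (fun x => #|row x|) x0C) => x xC xmax.
exists x => // b bR; apply: contraT => Nrxb.
have [y yC ryb] := rows b bR.
have /proper_card : row x \proper row y.
  apply/properP; split; last by exists b; rewrite !inE bR.
  by apply/subsetP => c; rewrite !inE => /andP[cR rxc]; rewrite cR (nest y x b c).
by rewrite ltnNge; have /= -> := xmax y yC.
Qed.

(** * Colourings and vertex-criticality *)

Lemma colorableP {G : sgraph} {k : nat} :
  reflect (exists c : {ffun G -> 'I_k}, forall x y, adj x y -> c x != c y)
          (colorable G k).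
Proof.
apply: (iffP existsP) => -[c hc]; exists c.
  by move=> x y; move/forallP/(_ x)/forallP/(_ y)/implyP: hc.
by apply/forallP => x; apply/forallP => y; apply/implyP => /hc.
Qed.

Lemma chromatic_colorable (G : sgraph) : colorable G (chromatic_number G).
Proof. by rewrite /chromatic_number; case: ex_minnP. Qed.

Lemma chromatic_min (G : sgraph) (k : nat) :
  colorable G k -> chromatic_number G <= k.
Proof. by rewrite /chromatic_number; case: ex_minnP => m _; apply. Qed.

(** If every neighbour of [u] were a neighbour of [v], a colouring of [G - u] would extend to [u]
    with the colour of [v], using fewer than [k] colours. *)
Lemma vertex_critical_incomparable {k : nat} {G : sgraph} :
  vertex_critical k G -> forall u v : G, u != v -> ~~ adj u v ->
  exists2 w, adj u w & ~~ adj v w.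
Proof.
move=> [chiG crit] u v neuv Nuv.
have [/existsP[w /andP[]]|none] := boolP [exists w, adj u w && ~~ adj v w].
  by exists w.
have dom w : adj u w -> adj v w.
  by move=> uw; apply: contraNT none => Nvw; apply/existsP; exists w; rewrite uw.
have /colorableP[c hc] := chromatic_colorable (delete_vertex u).
have vP : v \in [set~ u] by rewrite !inE eq_sym.
pose in_del w : delete_vertex u := insubd (exist _ v vP) (if w == u then v else w).
have in_delE w : val (in_del w) = if w == u then v else w.
  rewrite val_insubd; case: (eqVneq w u) => [_|neq]; first by rewrite vP.
  by rewrite !inE neq.
suff /chromatic_min : colorable G (chromatic_number (delete_vertex u)).
  by rewrite chiG leqNgt crit.
apply/colorableP; exists [ffun w => c (in_del w)] => x y xy.
rewrite !ffunE; apply: hc; rewrite /= /induced_adj !in_delE.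
case: (eqVneq x u) (eqVneq y u) => [xu|_] [yu|_] //.
- by move: xy; rewrite xu yu adj_irr.
- by rewrite dom // -xu.
- by rewrite adj_sym dom // -yu adj_sym.
Qed.

Lemma large_fiber {T K : finType} (f : T -> K) (A : {set T}) (m : nat) :
  #|K| * m < #|A| -> exists y, m < #|[set x in A | f x == y]|.
Proof.
move=> ltA; apply/existsP; apply: contraLR ltA => /existsPn small.
rewrite -leqNgt -sum1_card (partition_big f predT) //=.
rewrite -sum_nat_const; apply: leq_sum => y _.
by rewrite sum1dep_card leqNgt small.
Qed.

(* [ramsey_size k l j] vertices suffice when at most [j - 1] colours have not
   occurred yet. *)
Fixpoint ramsey_size (k l j : nat) : nat :=
  if j is j'.+1 then (k * k * ramsey_size k l j').+1 + l else l.

Lemma ramsey_size_ge (k l j : nat) : l <= ramsey_size k l j.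
Proof. by case: j => //= j; apply: leq_addl. Qed.

(** * Bounding the order *)

Section SquidFree.

Variables (k l : nat) (G : sgraph) (col : {ffun G -> 'I_k}).
Hypothesis l_gt0 : 0 < l.
Hypothesis col_proper : forall x y, adj x y -> col x != col y.
Hypothesis free2P2 : free_of two_P2 G.
Hypothesis free_squid : free_of (squid4 l) G.
Hypothesis incomparable : forall u v : G, u != v -> ~~ adj u v ->
  exists2 w, adj u w & ~~ adj v w.

Lemma same_color_nonadj x y : col x = col y -> ~~ adj x y.
Proof. by move=> cxy; apply/negP => /col_proper; rewrite cxy eqxx. Qed.

(** Otherwise the edges [x b] and [y c] would induce a [2P_2]. *)
Lemma nonadj_chain {x y b c : G} : ~~ adj x y -> ~~ adj b c ->
  adj x b -> ~~ adj y b -> adj y c -> adj x c.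
Proof.
move=> Nxy Nbc xb Nyb yc; apply: contraT => Nxc.
by case: (two_P2_freeP free2P2 _ _ _ _ xb yc); rewrite // adj_sym.
Qed.

Lemma independent_subset {A B : {set G}} : A \subset B ->
  {in B &, forall b c, ~~ adj b c} -> {in A &, forall b c, ~~ adj b c}.
Proof. by move=> /subsetP sAB ind b c bA cA; apply: ind; apply: sAB. Qed.

(* [marked R i]: the first half of a squid, with leaves in [R], has been found
   with its vertex [y] of colour [i]. *)
Definition marked (R : {set G}) (i : 'I_k) : Prop :=
  exists a x y : G, [/\ col y = i, adj y a, ~~ adj x a,
    {in R, forall b, [/\ adj x b, ~~ adj y b & ~~ adj a b]} & a != x].

Lemma marked_subset {A B : {set G}} {i : 'I_k} :
  A \subset B -> marked B i -> marked A i.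
Proof.
move=> /subsetP sAB [a [x [y [cy ya xa hR ax]]]]; exists a, x, y; split=> //.
by move=> b /sAB /hR.
Qed.

Lemma marked_step (R : {set G}) (m : nat) :
  {in R &, forall b c, ~~ adj b c} -> (k * k * m).+1 < #|R| ->
  exists (a : G) (i : 'I_k) (R' : {set G}),
  [/\ a \in R, R' \subset R, m < #|R'|, marked R' i &
     exists y, [/\ col y = i, adj y a & {in R', forall b, ~~ adj y b}]].
Proof.
move=> indR szR.
have /card_gt0P[a aR] : 0 < #|R| by apply: leq_trans szR.
pose sep (b : G) (p : 'I_k * 'I_k) :=
  [exists y, [&& col y == p.1, adj y a & ~~ adj y b]] &&
  [exists x, [&& col x == p.2, adj x b & ~~ adj x a]].
pose R1 := R :\ a.
have sepP b : b \in R1 -> exists p, sep b p.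
  rewrite !inE => /andP[neba bR].
  have neab : a != b by rewrite eq_sym.
  have [y ay Nby] := incomparable a b neab (indR a b aR bR).
  have [x bx Nax] := incomparable b a neba (indR b a bR aR).
  exists (col y, col x); apply/andP; split; apply/existsP.
    by exists y; rewrite eqxx !(adj_sym y) ay.
  by exists x; rewrite eqxx !(adj_sym x) bx.
(* By [sepP] the default value is never taken on [R1]. *)
pose f b := odflt (col a, col a) [pick p | sep b p].
have fP b : b \in R1 -> sep b (f b).
  move=> /sepP[p sp]; rewrite /f; case: pickP => //= none.
  by rewrite none in sp.
have [[i i'] szR'] : exists p, m < #|[set b in R1 | f b == p]|.
  apply: large_fiber; rewrite card_prod card_ord.
  (* The [.+1] in the size hypothesis pays for the removal of [a]. *)
  by move: szR; rewrite (cardsD1 a) aR.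
set R' := [set _ in _ | _] in szR'.
have sR'1 : R' \subset R1 by apply/subsetP => b; rewrite inE => /andP[].
have sR1 : R1 \subset R by apply: subsetDl.
have sR' := subset_trans sR'1 sR1.
have hsep b : b \in R' -> sep b (i, i').
  by rewrite inE => /andP[bR1 /eqP <-]; apply: fP.
have indR' := independent_subset sR' indR.
have R'n0 : R' != set0 by rewrite -card_gt0; apply: leq_ltn_trans szR'.
have [y] : exists2 y, y \in [set y | (col y == i) && adj y a] &
    forall b, b \in R' -> ~~ adj y b.
  (* The complements of a chain form a chain as well. *)
  apply: (nested_rows_common (r := fun y b => ~~ adj y b)) => //.
    move=> x y b c /setIdP[/eqP cx _] /setIdP[/eqP cy _] bR' cR'.
    move=> Nxb /negPn yb Nyc; apply: contraNN Nyc => xc.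
    have Nyx : ~~ adj y x by apply: same_color_nonadj; rewrite cx cy.
    exact: nonadj_chain Nyx (indR' b c bR' cR') yb Nxb xc.
  move=> b /hsep /andP[/existsP[y /and3P[cy ya Nyb]] _].
  by exists y; rewrite // !inE cy.
move=> /setIdP[/eqP cy ya] yR'.
have [x] : exists2 x, x \in [set x | (col x == i') && ~~ adj x a] &
    forall b, b \in R' -> adj x b.
  apply: nested_rows_common => //.
    move=> x z b c /setIdP[/eqP cx _] /setIdP[/eqP cz _] bR' cR'.
    apply: nonadj_chain; last exact: indR'.
    by apply: same_color_nonadj; rewrite cx cz.
  move=> b /hsep /andP[_ /existsP[x /and3P[cx xb Nxa]]].
  by exists x; rewrite // !inE cx.
move=> /setIdP[_ Nxa] xR'.
exists a, i, R'; split=> //; last by exists y.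
exists a, x, y; split=> //.
  by move=> b bR'; rewrite xR' // yR' // indR //; apply: (subsetP sR').
have /set0Pn[b bR'] := R'n0; apply: contraTneq (xR' b bR') => <-.
by rewrite indR //; apply: (subsetP sR').
Qed.

(** Induction on [j]: a larger [R] allows a round of [marked_step], whose colour either is new and
    joins [M], or lies in [M] and completes a squid. At [j = 0], [M] would have more than [k]
    colours. *)
Lemma independent_unmarked (j : nat) (R : {set G}) (M : {set 'I_k}) :
  {in R &, forall b c, ~~ adj b c} -> {in M, forall i, marked R i} ->
  k < #|M| + j -> #|R| <= ramsey_size k l j.
Proof.
elim: j R M => [|j IH] R M indR markM ltk.
  by move: ltk; rewrite addn0 ltnNge -[X in _ <= X]card_ord max_card.
rewrite leqNgt; apply/negP => szR.
have [|a' [i [R' [a'R sR' szR' markR' [y' [cy' y'a' y'R']]]]]] :=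
  marked_step R (ramsey_size k l j) indR.
  by apply: leq_ltn_trans szR; apply: leq_addr.
have [iM|iNM] := boolP (i \in M); last first.
  move: szR'; rewrite ltnNge => /negP; apply; apply: (IH R' (i |: M)).
  - exact: independent_subset sR' indR.
  - by move=> i0 /setU1P[-> //|/markM]; apply: marked_subset.
  - by rewrite cardsU1 iNM addSnnS.
have [a [x [y [cy ya Nxa hR neax]]]] := markM i iM.
have leR' : l <= #|R'| by apply: leq_trans (ramsey_size_ge k l j) (ltnW szR').
have /card_gt0P[b bR'] : 0 < #|R'| by apply: leq_trans leR'.
have {}hR' c : c \in R' -> [/\ adj x c, ~~ adj y c & ~~ adj a c].
  by move=> /(subsetP sR') /hR.
have [_ Nya' Naa'] := hR a' a'R.
have Nyy' : ~~ adj y y' by apply: same_color_nonadj; rewrite cy.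
(* Otherwise [y' a'] and [y a] would induce a [2P_2]. *)
have y'a : adj y' a.
  by apply: (nonadj_chain _ _ y'a' Nya' ya); rewrite adj_sym.
have [xb Nyb Nab] := hR' b bR'.
(* Otherwise [x b] and [z a] would induce a [2P_2]; taking [z] to be [y] and [y'] closes the
   cycle. *)
have to_x z : adj z a -> ~~ adj z b -> adj z x.
  move=> za Nzb; rewrite adj_sym; apply: contraT => Nxz.
  by case: (two_P2_freeP free2P2 _ _ _ _ xb za); rewrite // adj_sym.
apply: (squid4_freeP free_squid x y a y' R' leR') => //.
- by rewrite adj_sym to_x.
- by rewrite adj_sym.
- by rewrite to_x // y'R'.
- by apply: contraNneq Nya' => ->.
- exact: independent_subset sR' indR.
- by move=> c cR'; have [xc yc ac] := hR' c cR'; rewrite y'R'.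
Qed.

Lemma order_le : #|G| <= k * ramsey_size k l k.+1.
Proof.
rewrite leqNgt -cardsT -{1}(card_ord k); apply/negP => /(large_fiber col)[i].
rewrite ltnNge => /negP; apply.
(* A colour class is independent, and with no colour marked yet [j = k.+1] suffices. *)
apply: (independent_unmarked _ _ set0); last by rewrite cards0.
  move=> b c; rewrite !inE => /eqP cb /eqP cc.
  by apply: same_color_nonadj; rewrite cb.
by move=> ?; rewrite inE.
Qed.

End SquidFree.

(** * From bounded order to finitely many graphs *)

Section GraphOfSet.

Context {n : nat} (E : {set 'I_n * 'I_n}).

(** Forcing symmetry and irreflexivity makes every set of pairs the code of a graph, so that the
    codes form a finite type. *)
Definition set_adj : rel 'I_n :=
  fun i j => (i != j) && (((i, j) \in E) || ((j, i) \in E)).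

Lemma set_adj_sym : symmetric set_adj.
Proof. by move=> i j; rewrite /set_adj eq_sym orbC. Qed.

Lemma set_adj_irr : irreflexive set_adj.
Proof. by move=> i; rewrite /set_adj eqxx. Qed.

Definition graph_of_set : sgraph := SGraph set_adj_sym set_adj_irr.

End GraphOfSet.

Lemma isomorphic_graph_of_set (G : sgraph) :
  exists E : {set 'I_#|G| * 'I_#|G|}, isomorphic G (graph_of_set E).
Proof.
exists [set p | adj (enum_val p.1 : G) (enum_val p.2)].
exists enum_rank => [|x y]; first exact: enum_rank_bij.
rewrite /= /set_adj !inE /= !enum_rankK [adj y x]adj_sym orbb andb_idl // => xy.
by rewrite (inj_eq enum_rank_inj) adj_neq.
Qed.

Lemma finitely_many_bounded (P : sgraph -> Prop) (N : nat) :
  (forall G, P G -> #|G| <= N) -> finitely_many P.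
Proof.
move=> bound; pose code : finType := {n : 'I_N.+1 & {set 'I_n * 'I_n}}.
exists #|code|, (fun i => graph_of_set (tagged (enum_val i))) => G PG.
have [E isoE] := isomorphic_graph_of_set G.
have ltN : #|G| < N.+1 by rewrite ltnS bound.
pose c : code := existT (fun n : 'I_N.+1 => {set 'I_n * 'I_n})
  (@Ordinal N.+1 _ ltN) E.
by exists (enum_rank c); rewrite enum_rankK.
Qed.

Theorem theorem4p2 (k l : nat) (hk : 1 <= k) (hl : 1 <= l) :
  finitely_many (fun G : sgraph =>
    [/\ vertex_critical k G, free_of two_P2 G & free_of (squid4 l) G]).
Proof.
apply: (finitely_many_bounded _ (k * ramsey_size k l k.+1)) => G.
move=> [crit free2P2 free_squid].
have := chromatic_colorable G; rewrite (proj1 crit) => /colorableP[col hcol].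
exact: order_le hcol free2P2 free_squid (vertex_critical_incomparable crit).
Qed.
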